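(* Let $p$ be an odd prime and let $x$ be a variable. Then $$\sum_{k=0}^{p-1}\binom{2k}{k}^2\binom{4k}{2k}\bigl(x(1-64x)\bigr)^k\equiv \Bigl(\sum_{k=0}^{p-1}\binom{2k}{k}\binom{4k}{2k}x^k\Bigr)^2 \pmod{p^2}.$$
   Context: The congruence is between polynomials in $x$ with integer coefficients: it means that the difference of the two sides, as an element of $\mathbb{Z}[x]$, has all coefficients divisible by $p^2$. *)

(* Defs.v *)
From mathcomp Require Import all_boot all_order all_algebra.

Set Implicit Arguments.
Unset Strict Implicit.
Unset Printing Implicit Defensive.

Import GRing.Theory.
Local Open Scope ring_scope.

Definition poly_congr (m : int) (f g : {poly int}) : Prop :=
  forall i : nat, (m %| (f - g)`_i)%Z.

(* Main.v *)
Require Import Defs.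
From mathcomp Require Import all_boot all_order all_algebra.
From mathcomp Require Import zify ring.

Set Implicit Arguments.
Unset Strict Implicit.
Unset Printing Implicit Defensive.

Import GRing.Theory.
Local Open Scope ring_scope.

(** Below the degree p the congruence is an equality, and from the degree p on
    both sides vanish modulo p^2.

    Write a_k = C(2k,k) C(4k,2k) and b_k = C(2k,k) a_k. The series sum a_k x^k
    is the hypergeometric function 2F1(1/4,3/4;1;64x) and sum b_k y^k is
    3F2(1/4,1/2,3/4;1,1;256y). Clausen's formula says that
    sum b_k (x(1-64x))^k is the square of sum a_k x^k: both series satisfy the
    third-order differential equation (symmetric square) attached to the
    second-order equation of sum a_k x^k, and such a solution is determined by
    its constant term. Truncating the sums at k < p perturbs the differential
    equations only in degrees >= p-1, which leaves the coefficients in degrees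
    < p equal ([clausen_truncated]).

    In degrees n >= p the terms with 2k < p on the left have degree at most
    2k < p, and the others carry the factor C(2k,k)^2, divisible by p^2. On the
    right one meets products a_j a_l with j, l < p <= j + l; by Legendre's
    formula a_k is divisible by p when 4k >= p and by p^2 when 4k >= 3p. Either
    both factors are divisible by p, or one of the indices is below p/4, the
    other is then above 3p/4, and its factor is divisible by p^2. *)

(** * Coefficient recurrences *)

Definition cbin (k : nat) : int := 'C(2 * k, k)%:Z.

Definition coef2F1 (k : nat) : int := cbin k * cbin (2 * k).

Definition coef3F2 (k : nat) : int := cbin k * coef2F1 k.

Lemma cbinS k : k.+1%:Z * cbin k.+1 = 2 * (2 * k%:Z + 1) * cbin k.
Proof.
have e1 : ((2 * k.+1) * 'C((2 * k).+1, k) = k.+1 * 'C(2 * k.+1, k.+1))%N.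
  by rewrite (_ : 2 * k.+1 = (2 * k).+2)%N ?mul_bin_diag //; lia.
have e2 : ((2 * k).+1 * 'C(2 * k, k) = k.+1 * 'C((2 * k).+1, k))%N.
  rewrite mul_bin_diag -(@bin_sub (2 * k).+1 k.+1); last by lia.
  by congr (_ * 'C(_, _))%N; lia.
apply: (@mulfI int k.+1%:Z) => //; rewrite /cbin.
by rewrite -[_%:Z * _%:Z]PoszM -e1 [in RHS]mulrC; nia.
Qed.

(** [cbinS] is used at k, 2k and 2k+1; the factor 2(2k+1) that the
    product picks up is cancelled. *)
Lemma coef2F1S k :
  k.+1%:Z ^+ 2 * coef2F1 k.+1
    = (64 * k%:Z ^+ 2 + 64 * k%:Z + 12) * coef2F1 k.
Proof.
have e1 := cbinS k; have e2 := cbinS (2 * k); have e3 := cbinS (2 * k).+1.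
rewrite /coef2F1 (_ : 2 * k.+1 = (2 * k).+2)%N; last by lia.
apply: (@mulfI int (2 * (2 * k%:Z + 1))); first by lia.
transitivity ((2 * k%:Z + 1) * (k.+1%:Z * cbin k.+1)
              * ((2 * k).+2%:Z * cbin (2 * k).+2)); first by ring.
rewrite e1 e3.
transitivity (4 * (2 * k%:Z + 1) * cbin k * (4 * k%:Z + 3)
              * ((2 * k).+1%:Z * cbin (2 * k).+1)); first by ring.
by rewrite e2; ring.
Qed.

Lemma coef3F2S k :
  k.+1%:Z ^+ 3 * coef3F2 k.+1
  = (256 * k%:Z ^+ 3 + 384 * k%:Z ^+ 2 + 176 * k%:Z + 24) * coef3F2 k.
Proof.
rewrite /coef3F2.
transitivity ((k.+1%:Z * cbin k.+1) * (k.+1%:Z ^+ 2 * coef2F1 k.+1)).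
  by ring.
by rewrite cbinS coef2F1S; ring.
Qed.

(** * Polynomials vanishing to a given order at 0 *)

Definition vanish (m : nat) (q : {poly int}) :=
  forall i, (i < m)%N -> q`_i = 0.

Lemma vanish_factor m q : vanish m q -> q = 'X^m * drop_poly m q.
Proof.
move=> q0; apply/polyP => i; rewrite coefXnM coef_drop_poly.
by case: ltnP => [/q0 //|/subnK->].
Qed.

Lemma vanish_XnM m q : vanish m ('X^m * q).
Proof. by move=> i lt_im; rewrite coefXnM lt_im. Qed.

Lemma vanishD m q r : vanish m q -> vanish m r -> vanish m (q + r).
Proof. by move=> q0 r0 i lt_im; rewrite coefD q0 // r0 // addr0. Qed.

Lemma vanishN m q : vanish m q -> vanish m (- q).
Proof. by move=> q0 i lt_im; rewrite coefN q0 // oppr0. Qed.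

Lemma vanishMl m q r : vanish m q -> vanish m (r * q).
Proof.
by move=> /vanish_factor->; rewrite mulrCA; apply: vanish_XnM.
Qed.

Lemma vanish_comp m q w : vanish m q -> vanish m (q \Po ('X * w)).
Proof.
move=> /vanish_factor->; rewrite rmorphM rmorphXn /= comp_polyX exprMn -mulrA.
exact: vanish_XnM.
Qed.

(** * Differential operators *)

(** The Euler operator acts diagonally on monomials, which turns differential
    operators into recurrences on coefficients. *)
Definition theta (q : {poly int}) : {poly int} := 'X * q^`().

Lemma coef_theta q i : (theta q)`_i = i%:Z * q`_i.
Proof.
rewrite /theta coefXM; case: i => [|i] /=; first by rewrite mul0r.
by rewrite coef_deriv -mulr_natl natz.
Qed.

Lemma vanish_theta m q : vanish m q -> vanish m (theta q).
Proof. by move=> q0 i lt_im; rewrite coef_theta q0 // mulr0. Qed.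

Lemma coef_natM (n : nat) (q : {poly int}) i : (n%:R * q)`_i = n%:Z * q`_i.
Proof. by rewrite mulr_natl coefMn -mulr_natl natz. Qed.

Lemma coef_divX (e q r : {poly int}) i :
  'X * e = q - 'X * r -> e`_i = q`_i.+1 - r`_i.
Proof. by move/(congr1 (coefp i.+1)); rewrite /= coefB !coefXM. Qed.

(** The operator theta^2 - 4 x (4 theta + 1)(4 theta + 3), divided by x. *)
Definition ode2F1 (q : {poly int}) : {poly int} :=
  'X * (1 - 64%:R * 'X) * q^`()^`() + (1 - 128%:R * 'X) * q^`() - 12%:R * q.

(** The operator theta^3 - 8 y (2 theta + 1)(4 theta + 1)(4 theta + 3), divided
    by y. *)
Definition ode3F2 (q : {poly int}) : {poly int} :=
  'X ^+ 2 * (1 - 256%:R * 'X) * q^`()^`()^`()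
  + (3%:R * 'X - 1152%:R * 'X ^+ 2) * q^`()^`()
  + (1 - 816%:R * 'X) * q^`() - 24%:R * q.

(** The symmetric square of [ode2F1], i.e. the third-order operator that kills
    all products of two power series killed by [ode2F1]. *)
Definition symsq2F1 (q : {poly int}) : {poly int} :=
  'X ^+ 2 * (1 - 64%:R * 'X) ^+ 2 * q^`()^`()^`()
  + 3%:R * 'X * (1 - 64%:R * 'X) * (1 - 128%:R * 'X) * q^`()^`()
  + (1 - 432%:R * 'X + 27648%:R * 'X ^+ 2) * q^`()
  - 24%:R * (1 - 128%:R * 'X) * q.

Lemma X_ode2F1 q :
  'X * ode2F1 q = theta (theta q)
    - 'X * (64%:R * theta (theta q) + 64%:R * theta q + 12%:R * q).
Proof. by rewrite /ode2F1 /theta !(derivM, derivX); ring. Qed.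

Lemma X_ode3F2 q :
  'X * ode3F2 q = theta (theta (theta q))
    - 'X * (256%:R * theta (theta (theta q)) + 384%:R * theta (theta q)
            + 176%:R * theta q + 24%:R * q).
Proof. by rewrite /ode3F2 /theta !(derivM, derivD, derivX, derivC); ring. Qed.

Lemma X_symsq2F1 q :
  'X * symsq2F1 q = theta (theta (theta q))
    - 'X * ((128%:R - 4096%:R * 'X) * theta (theta (theta q))
            + 192%:R * (1 - 64%:R * 'X) * theta (theta q)
            + (112%:R - 11264%:R * 'X) * theta q
            + (24%:R - 3072%:R * 'X) * q).
Proof. by rewrite /symsq2F1 /theta !(derivM, derivD, derivX, derivC); ring. Qed.

(** The recurrence for the coefficients annihilates every coefficient of the
    left-hand side except the one of degree n, where the truncation cuts off the
    term that should compensate. *)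
Lemma ode2F1_coef2F1 n : vanish n (ode2F1 (\poly_(k < n.+1) coef2F1 k)).
Proof.
move=> i lt_in; rewrite (coef_divX _ (X_ode2F1 _)).
rewrite !coefD !coef_natM !coef_theta !coef_poly !ltnS lt_in (ltnW lt_in).
by have := coef2F1S i; set u := coef2F1 _; set v := coef2F1 _; lia.
Qed.

Lemma ode3F2_coef3F2 n : vanish n (ode3F2 (\poly_(k < n.+1) coef3F2 k)).
Proof.
move=> i lt_in; rewrite (coef_divX _ (X_ode3F2 _)).
rewrite !coefD !coef_natM !coef_theta !coef_poly !ltnS lt_in (ltnW lt_in).
by have := coef3F2S i; set u := coef3F2 _; set v := coef3F2 _; lia.
Qed.

Lemma deriv_nat (n : nat) : (n%:R : {poly int})^`() = 0.
Proof. by rewrite derivMn derivC mul0rn. Qed.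

Lemma deriv_natX (n : nat) : (n%:R * 'X : {poly int})^`() = n%:R.
Proof. by rewrite mulr_natl derivMn derivX. Qed.

(** The two cofactors are found by matching the terms in q q''', q' q'' and q q''
    successively; the remaining terms then agree. The Euler operator is used
    rather than the plain derivative because it does not lower the order of
    vanishing. *)
Lemma symsq2F1_sqr q :
  symsq2F1 (q ^+ 2) =
    (6%:R * 'X * (1 - 64%:R * 'X) * q^`() + 2%:R * (1 - 128%:R * 'X) * q)
      * ode2F1 q
    + 2%:R * (1 - 64%:R * 'X) * q * theta (ode2F1 q).
Proof.
rewrite /symsq2F1 /theta /ode2F1 expr2.
rewrite !(deriv_nat, deriv_natX, derivM, derivB, derivD, derivX, derivC).
by ring.
Qed.

(** By the chain rule, since y = x(1-64x) satisfies dy/dx = 1-128x and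
    (dy/dx)^2 = 1-256y. *)
Lemma symsq2F1_comp q :
  symsq2F1 (q \Po ('X * (1 - 64%:R * 'X))) =
    (1 - 128%:R * 'X) * (ode3F2 q \Po ('X * (1 - 64%:R * 'X))).
Proof.
set y := 'X * _.
have dy : y^`() = 1 - 128%:R * 'X.
  by rewrite /y derivM derivB deriv_natX derivX derivC; ring.
have cn n : (n%:R : {poly int}) \Po y = n%:R by rewrite rmorph_nat.
have c1 : 1 \Po y = 1 by rewrite rmorph1.
have cN r : (- r) \Po y = - (r \Po y) by rewrite raddfN.
rewrite /symsq2F1 /ode3F2.
rewrite !(deriv_nat, deriv_natX, deriv_comp, derivM, derivB, derivD, derivX,
          derivC, dy).
rewrite !(cn, c1, cN, comp_polyD, comp_polyM, comp_polyX).
by rewrite /y; ring.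
Qed.

(** The coefficient of degree i of [symsq2F1 q] is (i+1)^3 q_(i+1) plus a
    combination of the coefficients of q of degrees at most i: a solution with
    zero constant term is zero. *)
Lemma vanish_symsq2F1 n (q : {poly int}) :
  q`_0 = 0 -> vanish n (symsq2F1 q) -> vanish n.+1 q.
Proof.
move=> q0 Lq i; elim/ltn_ind: i => -[//|i] IH lt_in.
have qi : vanish i.+1 q by move=> j lt_ji; apply: IH => //; lia.
have := Lq i lt_in; rewrite (coef_divX _ (X_symsq2F1 _)).
(* The subtracted part only involves coefficients of degree at most i. *)
rewrite [X in _ - X](_ : _ = 0).
  by rewrite subr0 !coef_theta => /eqP; rewrite !mulf_eq0 /= => /eqP.
apply: (_ : vanish i.+1 _) => //.
by do !apply: vanishD; apply: vanishMl => //; do ?apply: vanish_theta.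
Qed.

Lemma clausen_truncated n :
  vanish n ((\poly_(k < n) coef3F2 k) \Po ('X * (1 - 64%:R * 'X))
            - (\poly_(k < n) coef2F1 k) ^+ 2).
Proof.
case: n => [//|n]; apply: vanish_symsq2F1.
  rewrite coefB -!horner_coef0 horner_comp !hornerE /= !horner_coef0 !coef_poly.
  by rewrite /coef3F2 /coef2F1 /cbin /= !bin0.
set P := _ \Po _; set Q := _ ^+ 2.
have -> : symsq2F1 (P - Q) = symsq2F1 P - symsq2F1 Q.
  by rewrite /symsq2F1 !derivB; ring.
rewrite /P /Q symsq2F1_comp symsq2F1_sqr.
have E2 := @ode2F1_coef2F1 n; have E3 := @ode3F2_coef3F2 n.
apply: vanishD; first exact/vanishMl/vanish_comp.
apply: vanishN; apply: vanishD; apply: vanishMl => //.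
exact: vanish_theta.
Qed.

(** * Divisibility of the coefficients *)

Lemma logn_fact_ge p n : prime p -> (n %/ p <= logn p n`!)%N.
Proof.
case: n => [|n] p_pr; first by rewrite div0n.
by rewrite logn_fact // big_ltn // expn1 leq_addr.
Qed.

Lemma logn_fact_small p n :
  prime p -> (n < p ^ 2)%N -> logn p n`! = (n %/ p)%N.
Proof.
case: n => [|n] p_pr lt_np2; first by rewrite div0n logn1.
rewrite logn_fact // big_ltn // expn1 big_nat big1 ?addn0 // => k /andP[k2 _].
by rewrite divn_small // (leq_trans lt_np2) // leq_pexp2l ?prime_gt0.
Qed.

Lemma dvdz_logn p e n : prime p -> (0 < n)%N -> (e <= logn p n)%N ->
  (p%:Z ^+ e %| n%:Z)%Z.
Proof. by move=> p_pr n_gt0 le_e; rewrite -rmorphXn dvdzE /= pfactor_dvdn. Qed.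

Lemma cbin_fact k : ('C(2 * k, k) * (k`! * k`!) = (2 * k)`!)%N.
Proof. by have := @bin_fact (2 * k) k; rewrite mul2n -addnn addnK; apply; lia. Qed.

Lemma logn_cbin p k : prime p -> (k < p)%N ->
  (2 * k %/ p <= logn p 'C(2 * k, k))%N.
Proof.
move=> p_pr lt_kp; have := logn_fact_ge (2 * k) p_pr.
rewrite -cbin_fact !lognM ?muln_gt0 ?fact_gt0 ?bin_gt0 //; last by lia.
by rewrite (@logn_fact_small p k) // ?(divn_small lt_kp) ?addn0 //; nia.
Qed.

(** The product is (4k)! / ((2k)! k!^2), where p does not divide k! and, p being
    odd, 2k < p^2, so that the valuation of (2k)! is exactly [2 * k %/ p]. *)
Lemma logn_coef2F1 p k : prime p -> odd p -> (k < p)%N ->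
  (4 * k %/ p - 2 * k %/ p <= logn p ('C(2 * k, k) * 'C(4 * k, 2 * k)))%N.
Proof.
move=> p_pr p_odd lt_kp; have p3 : (2 < p)%N by rewrite odd_prime_gt2.
have b1 : (0 < 'C(2 * k, k))%N by rewrite bin_gt0; lia.
have b2 : (0 < 'C(4 * k, 2 * k))%N by rewrite bin_gt0; lia.
have lt_kpp : (2 * k < p ^ 2)%N by nia.
have := logn_fact_ge (4 * k) p_pr; have := cbin_fact (2 * k).
rewrite (_ : 2 * (2 * k) = 4 * k)%N; last by lia.
move=> <-; have := cbin_fact k => /(congr1 (logn p)).
rewrite !lognM ?muln_gt0 ?fact_gt0 ?b1 ?b2 //.
rewrite (logn_fact_small p_pr lt_kpp) (@logn_fact_small p k) //; last by nia.
by rewrite (divn_small lt_kp); lia.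
Qed.

(** As k grows from 0 to p, the first quotient steps up at p/4, p/2 and 3p/4 and
    the second one at p/2, so that the steps at p/2 cancel. *)
Lemma leq_quarter_div p k : (k < p)%N ->
  ((p <= 4 * k) + (3 * p <= 4 * k) <= 4 * k %/ p - 2 * k %/ p)%N.
Proof.
move=> lt_kp; have p_gt0 : (0 < p)%N by lia.
have b m : (m <= 4 * k %/ p)%N = (m * p <= 4 * k)%N by rewrite leq_divRL.
have c m : (2 * k %/ p < m)%N = (2 * k < m * p)%N by rewrite ltn_divLR.
have := b 1%N; have := b 2%N; have := b 3%N; have := c 1%N; have := c 2%N.
lia.
Qed.

Theorem theorem2p4 (p : nat) (p_prime : prime p) (p_odd : odd p) :
  poly_congr (p%:Z ^+ 2)
    (\sum_(0 <= k < p)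
       ('C(2 * k, k)%:Z ^+ 2 * 'C(4 * k, 2 * k)%:Z) *:
         ('X * (1 - 64%:Z *: 'X)) ^+ k)
    ((\sum_(0 <= k < p)
        ('C(2 * k, k)%:Z * 'C(4 * k, 2 * k)%:Z) *: 'X^k) ^+ 2).
Proof.
have p3 : (2 < p)%N by rewrite odd_prime_gt2.
have coef2F1E k : coef2F1 k = ('C(2 * k, k) * 'C(4 * k, 2 * k))%N%:Z.
  by rewrite /coef2F1 /cbin PoszM mulnA.
have coef3F2E k : 'C(2 * k, k)%:Z ^+ 2 * 'C(4 * k, 2 * k)%:Z = coef3F2 k.
  by rewrite /coef3F2 coef2F1E PoszM mulrA.
set y : {poly int} := 'X * _.
have yE : y = 'X * (1 - 64%:R * 'X).
  by rewrite /y -mul_polyC -natz polyCMn.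
have -> : \sum_(0 <= k < p) ('C(2 * k, k)%:Z * 'C(4 * k, 2 * k)%:Z) *: 'X^k
          = \poly_(k < p) coef2F1 k.
  rewrite poly_def big_mkord; apply: eq_bigr => k _.
  by rewrite coef2F1E PoszM.
have size_y : (size y <= 3)%N.
  rewrite (leq_trans (size_polyMleq _ _)) // size_polyX /= ltnS.
  rewrite (leq_trans (size_polyD _ _)) // geq_max size_polyN.
  rewrite size_poly1 /= (leq_trans (size_scale_leq _ _)) //.
  by rewrite size_polyX.
move=> i; case: (ltnP i p) => [lt_ip | le_pi].
  rewrite (_ : \sum_(0 <= k < p) _ = (\poly_(k < p) coef3F2 k) \Po y).
    by rewrite yE clausen_truncated.
  rewrite poly_def big_mkord raddf_sum; apply: eq_bigr => k _ /=.
  by rewrite coef3F2E comp_polyZ rmorphXn /= comp_polyX.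
rewrite coefB rpredB //.
  rewrite coef_sum big_mkord rpred_sum // => k _; rewrite coefZ.
  have [lt2kp | le_p2k] := ltnP (2 * k) p.
    rewrite nth_default ?mulr0 ?dvdz0 //; have := size_poly_exp_leq y k.
    by move=> /leq_trans; apply; nia.
  rewrite -mulrA dvdz_mulr // dvdz_exp2r //.
  rewrite -(expr1 p%:Z) dvdz_logn ?bin_gt0 //; first by lia.
  apply: leq_trans (logn_cbin _ _) => //.
  by rewrite divn_gt0 //; lia.
rewrite expr2 coefM rpred_sum // => -[j /= lt_ji] _; rewrite !coef_poly.
case: ltnP => [lt_jp | _]; last by rewrite mul0r.
case: ltnP => [lt_lp | _]; last by rewrite mulr0.
rewrite !coef2F1E -PoszM; set l := (i - j)%N in lt_lp *.
have pos m : (0 < 'C(2 * m, m) * 'C(4 * m, 2 * m))%N.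
  by rewrite muln_gt0 !bin_gt0; lia.
apply: dvdz_logn; rewrite // ?(muln_gt0 (_ * _)) ?pos // lognM ?pos //.
apply: leq_trans (leq_add (logn_coef2F1 _ _ _) (logn_coef2F1 _ _ _)) => //.
have := leq_quarter_div lt_jp; have := leq_quarter_div lt_lp.
by case: (leqP p (4 * j)); case: (leqP (3 * p) (4 * j));
   case: (leqP p (4 * l)); case: (leqP (3 * p) (4 * l)); lia.
Qed.
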